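(* Let $(W,S)$ be a finite Coxeter system and $u,v\in W$ with $u\leq v$. Then every face of the Bruhat interval polytope $\Delta_{[u,v]}(p)$ is a Bruhat interval polytope $\Delta_{[x,y]}(p)$, for some $x,y\in W$ with $u\leq x\leq y\leq v$.
   Context: $W$ is identified with the finite reflection group acting on the real vector space $V$ of its standard geometric representation, with simple roots $\alpha_s$ and invariant inner product $(\cdot,\cdot)$; $\leq$ is Bruhat order and $[x,y]=\{z: x\leq z\leq y\}$. Fix $p\in V$ with $(p,\alpha_s)<0$ for all $s\in S$. For $x\leq y$, the Bruhat interval polytope $\Delta_{[x,y]}(p)$ is the convex hull of $\{z(p): z\in[x,y]\}$. *)

(* Defs.v *)
From HB Require Import structures.
From mathcomp Require Import all_boot all_order all_algebra.
From mathcomp Require Import classical_sets reals trigo.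
Set Implicit Arguments. Unset Strict Implicit. Unset Printing Implicit Defensive.
Import Order.TTheory GRing.Theory Num.Theory.
Local Open Scope ring_scope.
Local Open Scope classical_set_scope.

(* A Coxeter system of rank n is given by its Coxeter matrix m : 'I_n -> 'I_n -> nat,
   where the entry 0 encodes m_st = infinity. *)
Definition coxeter_matrix (n : nat) (m : 'I_n -> 'I_n -> nat) : Prop :=
  (forall i j, m i j = m j i) /\ (forall i, m i i = 1%N) /\
  (forall i j, i != j -> m i j != 1%N).

Section Geom.
Variables (R : realType) (n : nat) (m : 'I_n -> 'I_n -> nat).

(* Standard symmetric bilinear form on V = R^S (basis = simple roots):
   B(alpha_s, alpha_t) = - cos (pi / m_st)  (= -1 if m_st = infinity). *)
Definition cox_form : 'M[R]_n :=
  \matrix_(i, j) (if m i j == 0%N then -1 else - cos (pi / (m i j)%:R)).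

Definition ip (u v : 'cV[R]_n) : R := (u^T *m cox_form *m v) 0 0.

Definition sroot (s : 'I_n) : 'cV[R]_n := delta_mx s 0.

(* simple reflection: v |-> v - 2 B(alpha_s, v) alpha_s, as a matrix acting on columns *)
Definition sgen (s : 'I_n) : 'M[R]_n :=
  1%:M - 2%:R *: (sroot s *m (sroot s)^T *m cox_form).

Definition wordM (ws : seq 'I_n) : 'M[R]_n := foldr (fun s M => sgen s *m M) 1%:M ws.

Definition inW (w : 'M[R]_n) : Prop := exists ws, w = wordM ws.

Definition finiteW : Prop := exists l : seq 'M[R]_n, forall w, inW w -> w \in l.

Definition has_length (w : 'M[R]_n) (k : nat) : Prop :=
  (exists ws, w = wordM ws /\ size ws = k) /\
  (forall ws, w = wordM ws -> (k <= size ws)%N).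

(* reflections T = { w s w^-1 } *)
Definition is_reflection (t : 'M[R]_n) : Prop :=
  exists ws s, t = wordM ws *m sgen s *m wordM (rev ws).

Definition bruhat_step (x y : 'M[R]_n) : Prop :=
  inW x /\ exists t, is_reflection t /\ y = x *m t /\
  exists kx ky, has_length x kx /\ has_length y ky /\ (kx < ky)%N.

Inductive bruhat_le : 'M[R]_n -> 'M[R]_n -> Prop :=
| bruhat_refl x : inW x -> bruhat_le x x
| bruhat_trans x y z : bruhat_step x y -> bruhat_le y z -> bruhat_le x z.

Definition conv (A : set 'cV[R]_n) : set 'cV[R]_n :=
  [set q | exists (k : nat) (a : 'I_k -> 'cV[R]_n) (l : 'I_k -> R),
      (forall i, A (a i)) /\ (forall i, 0 <= l i) /\ \sum_(i < k) l i = 1 /\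
      q = \sum_(i < k) l i *: a i].

(* (nonempty) faces: sets of maximizers of a linear functional *)
Definition is_face (P F : set 'cV[R]_n) : Prop :=
  exists c : 'rV[R]_n,
    F = [set q | P q /\ forall q', P q' -> (c *m q') 0 0 <= (c *m q) 0 0].

Definition BIP (x y : 'M[R]_n) (p : 'cV[R]_n) : set 'cV[R]_n :=
  conv [set q | exists z, bruhat_le x z /\ bruhat_le z y /\ q = z *m p].

End Geom.

(* Main.v *)
Require Import Defs.
From HB Require Import structures.
From mathcomp Require Import all_boot all_order all_algebra.
From mathcomp Require Import monoid boolp.
From mathcomp Require Import classical_sets reals trigo.
From mathcomp Require Import ring zify.
Import Order.TTheory GRing.Theory Num.Theory.
Local Open Scope ring_scope.
Local Open Scope classical_set_scope.

(** The heart of the matter is that a Bruhat interval [u, v] is a Coxeter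
    matroid: for every w there is m in [u, v] with w z <= w m for all z in
    [u, v].  This goes by induction on the length of v, choosing a simple s with
    s v < v.  If u < s u the interval is stable under s; if s u < u and u is not
    below s v, it is s [s u, s v].  In the remaining case s u < u <= s v the
    maximum is found in s [s u, s v] when w < w s, and in [u, s v] otherwise:
    a maximum z outside [u, s v] would make s z a local, hence global, maximum
    for w s on the matroid [s u, s v], whereas that maximum lies above u.

    Given a linear functional c, choose w such that c is dominant in the chamber
    of w, ties being broken by positivity of roots.  The w-maximum of [u, v] is
    then the largest element of the set M of maximizers of z |-> c (z p); breaking
    ties the other way gives a smallest element.  Finally, if x <= y both maximize
    this function on [x, y], it is constant on [x, y], so M is an interval. *)

Set Implicit Arguments.
Unset Strict Implicit.
Unset Printing Implicit Defensive.

(** For inductions that climb in length, with measure [K] minus the length. *)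
Lemma subn_descent K k x y :
  (K - x < k.+1)%N -> (x < y)%N -> (y <= K)%N -> (K - y < k)%N.
Proof. lia. Qed.

(** * Bruhat order of a group acting on signed roots *)

Section SignedGroup.
Local Open Scope group_scope.

(* [Phi] is the set of roots, [a] the simple roots, [t b] the reflection in [b]. *)
Variables (W : groupType) (I Phi : Type) (g : I -> W) (a : I -> Phi)
  (act : W -> Phi -> Phi) (t : Phi -> W) (pos : Phi -> bool)
  (len : W -> nat) (K : nat).
Hypothesis act1 : forall b, act 1 b = b.
Hypothesis actM : forall x y b, act (x * y) b = act x (act y b).
Hypothesis t_act : forall x b, t (act x b) = x * t b * x^-1.
Hypothesis t_simple : forall i, t (a i) = g i.
Hypothesis tK : forall b, t b * t b = 1.
Hypothesis pos_t : forall b, pos (act (t b) b) = ~~ pos b.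
Hypothesis pos_simple : forall i, pos (a i).
Hypothesis pos_g : forall i b, t b <> g i -> pos (act (g i) b) = pos b.
Hypothesis len_t : forall x b, pos (act x^-1 b) = pos b -> (len x < len (t b * x))%N.
Hypothesis len_le : forall x, (len x <= K)%N.
Hypothesis gen_ind : forall P : W -> Prop,
  P 1 -> (forall i x, P x -> P (g i * x)) -> forall x, P x.

(** Comparing signs, instead of asking that [b] be positive, lets a root and its opposite give the
    same step. By [len_t] every step raises the length. *)
Definition step (x y : W) : Prop :=
  exists2 b, pos (act x^-1 b) = pos b & y = t b * x.

Inductive ble : W -> W -> Prop :=
| ble_refl x : ble x x
| ble_cons x y z : step x y -> ble y z -> ble x z.

(** Left ascent: it holds exactly when [g i * x] lies above [x]. *)
Definition low i x := pos (act x^-1 (a i)).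

Lemma step_le x y : step x y -> ble x y.
Proof. by move=> h; apply: ble_cons h (ble_refl _). Qed.

Lemma ble_trans y x z : ble x y -> ble y z -> ble x z.
Proof. by elim=> // {}x x' {}y h _ ih /ih; apply: ble_cons. Qed.

Lemma step_len x y : step x y -> (len x < len y)%N.
Proof. by case=> b hb ->; apply: len_t. Qed.

Lemma ble_len x y : ble x y -> x = y \/ (len x < len y)%N.
Proof.
elim=> [|{}x z {}y /step_len h _ [<-|h']]; [by left | by right|right].
exact: ltn_trans h h'.
Qed.

Lemma ble_anti x y : ble x y -> ble y x -> x = y.
Proof.
move=> /ble_len [//|h] /ble_len [//|h'].
by have := ltn_trans h h'; rewrite ltnn.
Qed.

Lemma step_irrefl x y : step x y -> ~ ble y x.
Proof.
move=> h h'; have := ble_anti (step_le h) h'.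
by move: (step_len h) => + e; rewrite e ltnn.
Qed.

Lemma gK i x : g i * (g i * x) = x.
Proof. by rewrite mulgA -t_simple tK mul1g. Qed.

Lemma invg_g i : (g i)^-1 = g i.
Proof. by apply: (mulgI (g i)); rewrite mulgV -t_simple tK. Qed.

Lemma actK x b : act x (act x^-1 b) = b.
Proof. by rewrite -actM mulgV act1. Qed.

Lemma actKV x b : act x^-1 (act x b) = b.
Proof. by rewrite -actM mulVg act1. Qed.

Lemma pos_opp x b : pos (act x (act (t b) b)) = ~~ pos (act x b).
Proof. by rewrite -pos_t t_act -!actM mulgVK. Qed.

Lemma step_pos x y : step x y ->
  exists b, [/\ pos b, pos (act x^-1 b) & y = t b * x].
Proof.
case=> b hb ->; case hp: (pos b); first by exists b; rewrite hb hp.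
exists (act (t b) b); rewrite pos_t pos_opp hb hp t_act; split=> //.
by rewrite mulgK.
Qed.

(** The root witnessing a step need not be [b], so the converse uses length: with differing signs,
    [t b] would also give a step from [t b * x] to [x]. *)
Lemma step_tP x b : step x (t b * x) <-> pos (act x^-1 b) = pos b.
Proof.
split=> [h|hb]; last by exists b.
case: (boolP (pos (act x^-1 b) == pos b)) => [/eqP //|hn].
suff /step_len h' : step (t b * x) x by have := ltn_trans (step_len h) h'; rewrite ltnn.
exists b; last by rewrite mulgA tK mul1g.
have -> : (t b * x)^-1 = x^-1 * t b by rewrite invgM -[(t b)^-1]mulg1 -(tK b) mulKg.
by rewrite actM pos_opp; case: (pos _) (pos _) hn => [] [].
Qed.

Lemma mul_t w b x : w * (t b * x) = t (act w b) * (w * x).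
Proof. by rewrite t_act !mulgA mulgVK. Qed.

Lemma step_mulP w x b :
  step (w * x) (w * (t b * x)) <-> pos (act x^-1 b) = pos (act w b).
Proof. by rewrite mul_t step_tP invgM actM actKV. Qed.

Lemma step_t_total x b : step x (t b * x) \/ step (t b * x) x.
Proof.
case: (boolP (pos (act x^-1 b) == pos b)) => [/eqP /step_tP|hn]; [by left|right].
exists b; last by rewrite mulgA tK mul1g.
have -> : (t b * x)^-1 = x^-1 * t b by rewrite invgM -[(t b)^-1]mulg1 -(tK b) mulKg.
by rewrite actM pos_opp; case: (pos _) (pos _) hn => [] [].
Qed.

Lemma step_adj w x y : step (w * x) (w * y) -> step x y \/ step y x.
Proof.
case=> b _ e; have -> : y = t (act w^-1 b) * x.
  by apply: (mulgI w); rewrite e mul_t actK.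
exact: step_t_total.
Qed.

(** * Left ascents and the lifting property *)

Lemma lowP i x : low i x <-> step x (g i * x).
Proof. by rewrite -t_simple step_tP pos_simple. Qed.

Lemma low_g i x : low i (g i * x) = ~~ low i x.
Proof. by rewrite /low invgM actM invg_g -[in LHS](t_simple i) pos_opp. Qed.

Lemma upP i x : ~~ low i x <-> step (g i * x) x.
Proof. by rewrite -low_g lowP gK. Qed.

(** By [pos_g], [g i] keeps the sign of every root whose reflection is not [g i], so any other step
    survives the translation. *)
Lemma step_g i x y : step x y -> y = g i * x \/ step (g i * x) (g i * y).
Proof.
case=> b hb ->; have [e|/eqP ne] := eqVneq (t b) (g i); [by left; rewrite e|right].
by apply/step_mulP; rewrite pos_g.
Qed.

(** The lifting property. The chain is translated by [g i] link by link; at a link that is itself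
    multiplication by [g i], the translated chain joins the original one. *)
Lemma up_le i x y : ble x y -> ~~ low i y -> ble (g i * x) y.
Proof.
elim=> {x y} [x /upP /step_le // | x x' y h h' ih hy].
case: (step_g i h) => [<- //|h2].
exact: ble_cons h2 (ih hy).
Qed.

Lemma ble_ind_r (P : W -> W -> Prop) : (forall x, P x x) ->
  (forall x y z, ble x y -> P x y -> step y z -> P x z) ->
  forall x y, ble x y -> P x y.
Proof.
move=> h0 hs x y h.
suff : forall x0, ble x0 x -> P x0 x -> P x0 y by apply; [exact: ble_refl | exact: h0].
elim: h => // {}x x' {}y h _ ih x0 hx hp; apply: ih; last exact: hs hp h.
exact: ble_trans hx (step_le h).
Qed.

Lemma low_le i x y : ble x y -> low i x -> ble x (g i * y).
Proof.
move=> h; elim/ble_ind_r: x y / h => [x /lowP /step_le //|x y z h ih hs hl].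
case: (step_g i hs) => [->|/step_le h2]; first by rewrite gK.
exact: ble_trans (ih hl) h2.
Qed.

Lemma low_low_le i x y : ble x y -> low i x -> low i y -> ble (g i * x) (g i * y).
Proof.
move=> h hx hy; apply: up_le; first exact: low_le.
by rewrite low_g negbK.
Qed.

Lemma up_up_le i x y : ble x y -> ~~ low i x -> ~~ low i y -> ble (g i * x) (g i * y).
Proof.
move=> h hx hy; apply: low_le; first exact: up_le.
by rewrite low_g.
Qed.

(** Every [y] is reached from [x] by left multiplications with generators, and by [up_le] these
    never leave the set below [x]. *)
Lemma top_le x : (forall i, ~~ low i x) -> forall y, ble y x.
Proof.
move=> hx y; rewrite -[y](mulgVK x); elim/gen_ind: (y * x^-1).
  by rewrite mul1g; apply: ble_refl.
by move=> i z ih; rewrite -mulgA; apply: up_le.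
Qed.

Lemma bot_le x : (forall i, low i x) -> forall y, ble x y.
Proof.
move=> hx y; rewrite -[y](mulgVK x); elim/gen_ind: (y * x^-1).
  by rewrite mul1g; apply: ble_refl.
by move=> i z ih; rewrite -mulgA; apply: low_le.
Qed.

Lemma step_gl_low i w x : low i x -> pos (act w (a i)) -> step (w * x) (w * (g i * x)).
Proof. by move=> h h'; rewrite -t_simple; apply/step_mulP; rewrite h'. Qed.

Lemma step_gl_up i w x : ~~ low i x -> ~~ pos (act w (a i)) -> step (w * x) (w * (g i * x)).
Proof.
by move=> /negbTE h /negbTE h'; rewrite -t_simple; apply/step_mulP; rewrite h'.
Qed.

(** * Coxeter matroids and their maxima *)

Definition itv u v z := ble u z /\ ble z v.

Definition is_max (A : W -> Prop) w m := A m /\ forall z, A z -> ble (w * z) (w * m).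

(** The maximality property of Gelfand and Serganova, with [w] where the usual twisted order has its
    inverse. *)
Definition matroid (A : W -> Prop) := forall w, exists m, is_max A w m.

(* Replacing w by r w, where r w x > w x, preserves local maximality, so the
   induction starts at w x = w0, the longest element. *)
Lemma local_max_is_max (A : W -> Prop) w x : matroid A -> A x ->
  (forall y, A y -> step x y \/ step y x -> ~ step (w * x) (w * y)) -> is_max A w x.
Proof.
move=> hA hx; have [k hk] := ubnP (K - len (w * x)).
elim: k w hk => // k ih w hk hloc.
case: (pselect (exists i, low i (w * x))) => [[i hi]|hn]; last first.
  split=> // z _; apply: top_le => i.
  by apply/negP => hi; apply: hn; exists i.
have hs : step (w * x) (g i * (w * x)) by apply/lowP.
have hlt := step_len hs; have := len_le (g i * (w * x)) => hK.
have [_ hm1] : is_max A (g i * w) x.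
  apply: ih; first by rewrite -mulgA; exact: (subn_descent hk hlt hK).
  move=> y hy hxy; rewrite -!mulgA => h.
  case: (step_g i h) => [e|]; last by rewrite !gK; exact: hloc.
  by have := ltn_trans hlt (step_len h); rewrite e gK ltnn.
have [m [hAm hm]] := hA w.
suff e : x = m by rewrite e.
have h1 := hm _ hx; have := hm1 _ hAm; rewrite -!mulgA => h2.
have hup : ~~ low i (g i * (w * x)) by rewrite low_g hi.
(* If [i] is an ascent of [w * m], removing [g i] from [h2] reverses [h1]. Otherwise lifting forces
   [w * m = g i * (w * x)], so [m] is a neighbour of [x] that contradicts local maximality. *)
case hwm: (low i (w * m)).
  have := @up_up_le i _ _ h2; rewrite !gK low_g hwm => /(_ isT hup) h3.
  exact/(mulgI w)/ble_anti.
have := up_le h2 hup; rewrite gK => h3.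
have := up_le h1 (negbT hwm) => h4.
have e := ble_anti h3 h4; rewrite -e in hs.
by case: (hloc m hAm (step_adj hs) hs).
Qed.

(** Such a [w] is the longest element: it carries the root of a step to one of opposite sign, so the
    translated step runs backwards. *)
Lemma neg_antitone w : (forall b, pos (act w b) = ~~ pos b) ->
  forall x y, ble x y -> ble (w * y) (w * x).
Proof.
move=> hw x y; elim=> {x y} [x|x x' y [b hb ->] _ ih]; first exact: ble_refl.
apply: ble_trans ih (step_le _); rewrite mul_t.
case: (step_t_total (w * x) (act w b)) => // /step_tP.
by rewrite invgM actM actKV hb hw; case: (pos b).
Qed.

Lemma top_neg w : (forall y, ble y w) -> forall b, pos (act w b) = ~~ pos b.
Proof.
move=> hw b; case: (boolP (pos (act w b) == ~~ pos b)) => [/eqP //|h].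
suff hs : step w (t (act w b) * w) by case: (step_irrefl hs).
by apply/step_tP; rewrite actKV; case: (pos b) (pos _) h => [] [].
Qed.

(* The w-maximum decreases as w increases; the last w with w < w s is w0 s, for
   which it is s u. *)
Lemma max_ge_low u v w i m : matroid (itv u v) -> low i u -> ble (g i * u) v ->
  pos (act w (a i)) -> is_max (itv u v) w m -> ble (g i * u) m.
Proof.
move=> hmat hu huv; have [k hk] := ubnP (K - len w).
elim: k w m hk => // k ih w m hk hw [hAm hm].
case: (pselect (exists r, low r w /\ pos (act (g r * w) (a i)))) => [[r [hr hrw]]|hn].
  have hs : step w (g r * w) by apply/lowP.
  have hlt := step_len hs; have hK := len_le (g r * w).
  have [m1 [hAm1 hm1]] := hmat (g r * w).
  have hum1 : ble (g i * u) m1 by apply: (ih _ _ (subn_descent hk hlt hK) hrw).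
  apply: ble_trans hum1 _.
  have h1 := hm _ hAm1; have := hm1 _ hAm; rewrite -!mulgA => h2.
  (* Lifting gives [m1 = m] in every case but one; there [w * m = g r * (w * m1)], and [m1] steps up
     to [m]. *)
  case h3: (low r (w * m1)); case h4: (low r (w * m)).
  - have := @up_up_le r _ _ h2; rewrite !gK !low_g h3 h4 => /(_ isT isT) h5.
    by rewrite (mulgI w _ _ (ble_anti h1 h5)); apply: ble_refl.
  - have hup : ~~ low r (g r * (w * m1)) by rewrite low_g h3.
    have := up_le h2 hup; rewrite gK => h5.
    have e := ble_anti h5 (up_le h1 (negbT h4)).
    apply: step_le; have -> : m = t (act w^-1 (a r)) * m1.
      by apply: (mulgI w); rewrite e mul_t actK t_simple.
    apply/step_tP; rewrite -actM -invgM; rewrite /low in h3 hr.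
    by rewrite h3 hr.
  - have /step_le h5 : step (g r * (w * m1)) (w * m1) by apply/upP; rewrite h3.
    have /step_le h6 : step (w * m) (g r * (w * m)) by apply/lowP.
    have h7 := ble_trans h6 (ble_trans h2 h5).
    by rewrite (mulgI w _ _ (ble_anti h1 h7)); apply: ble_refl.
  - have h5 := up_up_le h1 (negbT h3) (negbT h4).
    by rewrite (mulgI w _ _ (mulgI _ _ _ (ble_anti h5 h2))); apply: ble_refl.
(* No admissible [r] remains, so each left ascent [r] of [w] turns the root [act w (a i)] negative,
   which forces its reflection to be [g r]. It follows that [w * g i] has no left ascent: it is the
   longest element. *)
have hterm r : low r w -> w * g i = g r * w.
  move=> hr; have [e|/eqP ne] := eqVneq (t (act w (a i))) (g r).
    by rewrite -e t_act t_simple mulgVK.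
  by case: hn; exists r; rewrite actM pos_g.
have hstep : step w (w * g i).
  have -> : w * g i = t (act w (a i)) * w by rewrite t_act t_simple mulgVK.
  by apply/step_tP; rewrite actKV hw pos_simple.
have htop : forall y, ble y (w * g i).
  apply: top_le => r; rewrite /low invgM invg_g actM.
  case hr: (low r w).
    have e := hterm _ hr.
    have <- : t (act w^-1 (a r)) = g i.
      by rewrite t_act t_simple invgK -mulgA -e mulKg.
    by rewrite pos_t; apply/negPn.
  rewrite pos_g ?hr //; first by rewrite -/(low r w) hr.
  rewrite t_act t_simple invgK => e.
  have e' : w * g i = g r * w by rewrite -e !mulgA mulgV mul1g.
  have /upP /step_len := negbT hr.
  by move/ltn_trans => /(_ _ (step_len hstep)); rewrite e' ltnn.
have hneg := top_neg htop.
(* If [i] were an ascent of [m], then [g i * u] would lie in the interval, and maximality there,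
   reversed by the inverse of [w * g i], would put [g i * m] below [u] and hence below [m]. *)
case hmi: (low i m); last by apply: up_le; [case: hAm | rewrite hmi].
have hle : ble (w * (g i * u)) (w * m).
  apply: hm; split=> //; apply: step_le; exact/lowP.
have hneg' b : pos (act (w * g i)^-1 b) = ~~ pos b.
  by rewrite -[in RHS](actK (w * g i) b) hneg negbK.
have := neg_antitone hneg' hle.
rewrite !invgM !invg_g -!mulgA !mulKg gK => h.
have /step_irrefl : step m (g i * m) by apply/lowP.
by case; apply: ble_trans h _; case: hAm.
Qed.

(** * Bruhat intervals are Coxeter matroids *)

Lemma is_max_stable (A B : W -> Prop) w i m :
  (forall z, B z -> A (g i * z)) -> (forall z, A z -> B (g i * z)) ->
  is_max A (w * g i) m -> is_max B w (g i * m).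
Proof.
move=> hBA hAB [hm h]; split; first exact: hAB.
by move=> z /hBA /h; rewrite -!mulgA gK.
Qed.

Lemma maximal_above (A : W -> Prop) w z : A z ->
  exists z', [/\ A z', ble (w * z) (w * z') &
    forall y, A y -> ble (w * z') (w * y) -> y = z'].
Proof.
have [k hk] := ubnP (K - len (w * z)); elim: k z hk => // k ih z hk hz.
case: (pselect (exists y, [/\ A y, ble (w * z) (w * y) & y <> z])) => [[y [hy hl hne]]|hn].
  have hlt : (len (w * z) < len (w * y))%N.
    by case: (ble_len hl) => // /mulgI e; case: hne.
  have hK := len_le (w * y); have [//|z' [? h ?]] := ih y (subn_descent hk hlt hK).
  by exists z'; split=> //; apply: ble_trans hl h.
exists z; split=> // [|y hy hl]; first exact: ble_refl.
by case: (eqVneq y z) => // /eqP ne; case: hn; exists y.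
Qed.

Lemma matroid_itv u v : ble u v -> matroid (itv u v).
Proof.
have [k hk] := ubnP (len v); elim: k u v hk => // k ih u v hk huv.
case: (pselect (exists i, ~~ low i v)) => [[i hv]|hn]; last first.
  have hb : forall y, ble v y.
    by apply: bot_le => i; apply/negPn/negP => hi; apply: hn; exists i.
  have e : u = v := ble_anti huv (hb u); rewrite -{}e {v hk huv hn hb} => w.
  exists u; split; first by split; apply: ble_refl.
  by move=> z [h1 h2]; rewrite (ble_anti h1 h2); apply: ble_refl.
have hlt : (len (g i * v) < k)%N by have /upP /step_len h := hv; apply: leq_trans h hk.
have hsv : low i (g i * v) by rewrite low_g.
have hsvv : ble (g i * v) v by apply/step_le/upP.
have down z : ble z v -> low i z -> ble z (g i * v) by apply: low_le.
have up_dn z : ble z v -> ~~ low i z -> ble (g i * z) (g i * v).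
  by move=> h hz; apply: up_up_le.
case hu: (low i u).
  have stab z : itv u v z -> itv u v (g i * z).
    by case=> h1 h2; split; [apply: low_le|apply: up_le].
  have husv : ble u (g i * v) by apply: low_le.
  have sub z : itv u (g i * v) z -> itv u v z by case=> ? ?; split=> //; apply: ble_trans hsvv.
  (* When [act w (a i)] is negative, the lower element of each pair [z], [g i * z] is the [w]-larger
     one, so the maximum over [[u, g i * v]] suffices. *)
  have caseneg w : ~~ pos (act w (a i)) -> exists m, is_max (itv u v) w m.
    move=> hw; have [m [hm1 hm2]] := ih _ _ hlt husv w.
    exists m; split; first exact: sub.
    move=> z hz; case hzl: (low i z).
      by apply: hm2; case: hz => ? ?; split=> //; apply: down.
    apply: (@ble_trans (w * (g i * z))); first by apply/step_le/step_gl_up; rewrite ?hzl.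
    by apply: hm2; case: (stab _ hz) => ? ?; split=> //; apply: down; rewrite // low_g hzl.
  move=> w; case hw: (pos (act w (a i))); last by apply: caseneg; rewrite hw.
  have [|m hm] := caseneg (w * g i).
    by rewrite actM -[in act (g i) _](t_simple i) pos_opp hw.
  by exists (g i * m); apply: is_max_stable hm.
have hsu : low i (g i * u) by rewrite low_g hu.
have hsusv : ble (g i * u) (g i * v) by apply: up_up_le; rewrite ?hu.
have hsuu : ble (g i * u) u by apply/step_le/upP; rewrite hu.
have hmat' := ih _ _ hlt hsusv.
have to_lower z : itv u v z -> ~~ low i z -> itv (g i * u) (g i * v) (g i * z).
  by case=> h1 h2 hz; split; [apply: up_up_le; rewrite ?hu|apply: up_dn].
have to_upper z : itv (g i * u) (g i * v) z -> low i z -> itv u v (g i * z).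
  case=> h1 h2 hz; split; last by apply: up_le => //; apply: ble_trans hsvv.
  by have := low_low_le h1 hsu hz; rewrite gK.
(* If [u] is not below [g i * v], all of [[u, v]] descends under [i] and all of [[g i * u, g i * v]]
   ascends, so [g i] matches the two intervals. *)
case: (pselect (ble u (g i * v))) => husv; last first.
  move=> w; have [m [hm1 hm2]] := hmat' (w * g i).
  have hup z : itv u v z -> ~~ low i z.
    by case=> h1 h2; apply/negP => /(down _ h2) h3; apply: husv; apply: ble_trans h3.
  have hlow z : itv (g i * u) (g i * v) z -> low i z.
    case=> h1 h2; case hz: (low i z) => //; case: husv; apply: ble_trans h2.
    by have := up_le h1 (negbT hz); rewrite gK.
  exists (g i * m); split; first by apply: to_upper => //; apply: hlow.
  by move=> z hz; have := hm2 _ (to_lower _ hz (hup _ hz)); rewrite -!mulgA gK.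
have upper z : itv (g i * u) (g i * v) z -> ~~ low i z -> ble u z.
  by case=> h1 _ hz; have := up_le h1 hz; rewrite gK.
move=> w; case hw: (pos (act w (a i))).
  have [m [hm1 hm2]] := hmat' (w * g i).
  (* Otherwise [g i * m] would also lie in [[g i * u, g i * v]] and be strictly larger than [m] for
     [w * g i]. *)
  have hml : low i m.
    case hml: (low i m) => //.
    have hum := upper _ hm1 (negbT hml).
    have hA : itv (g i * u) (g i * v) (g i * m).
      split; first by apply: up_up_le; rewrite ?hu ?hml.
      by case: hm1 => _; apply: ble_trans; apply/step_le/upP; rewrite hml.
    have := hm2 _ hA; rewrite -!mulgA gK => h.
    suff /step_irrefl : step (w * (g i * m)) (w * m) by case.
    have := @step_gl_low i w (g i * m); rewrite gK; apply=> //.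
    by rewrite low_g hml.
  exists (g i * m); split; first exact: to_upper.
  move=> z hz; case hzl: (low i z); last first.
    by have := hm2 _ (to_lower _ hz (negbT hzl)); rewrite -!mulgA gK.
  apply: (@ble_trans (w * (g i * z))); first by apply/step_le/step_gl_low.
  have hz' : itv (g i * u) (g i * v) z.
    by case: hz => h1 h2; split; [apply: ble_trans h1|apply: down].
  by have := hm2 _ hz'; rewrite -!mulgA.
have maximal_low z : itv u v z ->
    (forall y, itv u v y -> ble (w * z) (w * y) -> y = z) -> ble z (g i * v).
  move=> hz hzmax; case hzl: (low i z); first by case: hz => _ /down; apply.
  case: (pselect (ble z (g i * v))) => // hzv; exfalso.
  have hzv' : ~~ low i z by rewrite hzl.
  have hxl : low i (g i * z) by rewrite low_g.
  have huz : ~ ble u (g i * z).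
    move=> h; have hA : itv u v (g i * z).
      by split=> //; apply: up_le; [case: hz|].
    have hs : step (w * z) (w * (g i * z)) by apply: step_gl_up => //; rewrite hw.
    have e := hzmax _ hA (step_le hs); rewrite e in hs.
    exact: step_irrefl hs (ble_refl _).
  have hx := to_lower _ hz hzv'.
  have hlocal : is_max (itv (g i * u) (g i * v)) (w * g i) (g i * z).
    apply: local_max_is_max => // y hy hxy hs.
    (* A neighbour [y] not ascending under [i] would give either [z] below [g i * v] or [u] below
       [g i * z]. Once [y] ascends, [g i * y] lies in [[u, v]] and beats [z]. *)
    have hyl : low i y.
      case hyl: (low i y) => //; case: hxy => /step_le hxy.
        by case: hzv; have := up_le hxy (negbT hyl); rewrite gK => /ble_trans; apply; case: hy.
      by case: huz; apply: ble_trans hxy; apply: upper; rewrite ?hyl.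
    have := hzmax _ (to_upper _ hy hyl); move: (step_le hs); rewrite -!mulgA gK => h1 /(_ h1) e.
    by move: hs; rewrite -e gK => /step_irrefl; apply; apply: ble_refl.
  apply: huz; have := max_ge_low hmat' hsu _ _ hlocal; rewrite gK; apply=> //.
  by rewrite actM -[in act (g i) _](t_simple i) pos_opp hw.
have [m [hm1 hm2]] := ih _ _ hlt husv w.
exists m; split; first by case: hm1 => ? ?; split=> //; apply: ble_trans hsvv.
move=> z hz; have [z' [hz' hle hmax]] := maximal_above w hz.
apply: ble_trans hle _; apply: hm2; split; first by case: hz'.
exact: maximal_low.
Qed.

(** * Linear functionals on Bruhat intervals *)

Local Open Scope ring_scope.
Variable R : realType.

(* Abstracts [f x = c (x p)], [cf b = c b], for [p] with (p, a i) < 0. *)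
Definition linear_on (f : W -> R) (cf : Phi -> R) := forall x b, exists2 k, 0 < k &
  f (t b * x)%g = f x + (if pos (act x^-1%g b) then k else - k) * cf b.

Lemma linear_on_mul f cf w : linear_on f cf ->
  linear_on (fun x => f (w * x)%g) (fun b => cf (act w b)).
Proof.
move=> h x b; have [k k0 hk] := h (w * x)%g (act w b).
by exists k; rewrite // mul_t hk invgM actM actKV.
Qed.

Lemma linear_on_low f cf i x : linear_on f cf -> low i x ->
  exists2 k, 0 < k & f (g i * x)%g = f x + k * cf (a i).
Proof.
move=> h hx; have [k k0] := h x (a i); rewrite t_simple -/(low i x) hx => e.
by exists k.
Qed.

(** Induction on the length of [y] through a left descent [i]. If [i] is an ascent of [x], both
    [g i * x] and [g i * y] lie in the interval, which forces [cf (a i) = 0] and reduces to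
    [[x, g i * y]]. If not, the induction is applied to the function translated by [g i] on
    [[g i * x, g i * y]]. *)
Lemma constant_itv f cf x y : linear_on f cf -> ble x y ->
  (forall z, itv x y z -> f z <= f x) -> f y = f x ->
  forall z, itv x y z -> f z = f x.
Proof.
have [k hk] := ubnP (len y); elim: k x y f cf hk => // k ih x y f cf hk hf hxy hmax hfy z hz.
case: (pselect (exists i, ~~ low i y)) => [[i hy]|hn]; last first.
  have hb : forall y', ble y y'.
    by apply: bot_le => i; apply/negPn/negP => hi; apply: hn; exists i.
  by case: hz => h1 h2; rewrite -hfy (ble_anti h2 (hb z)).
have hlt : (len (g i * y)%g < k)%N by have /upP /step_len h := hy; apply: leq_trans h hk.
have hsy : low i (g i * y) by rewrite low_g.
have hsyy : ble (g i * y) y by apply/step_le/upP.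
have [ky ky0] := linear_on_low hf hsy; rewrite gK hfy => hky.
have down z' : itv x y z' -> low i z' -> itv x (g i * y) z'.
  by case=> h1 h2 hl; split=> //; apply: low_le.
have cge0 : ble x (g i * y) -> 0 <= cf (a i).
  move=> h; have := hmax (g i * y)%g (conj h hsyy).
  rewrite hky lerDl => h'.
  by move: h'; rewrite pmulr_rge0.
have fs z' : cf (a i) = 0 -> f (g i * z')%g = f z'.
  move=> c0; have [k' _ ->] : exists2 k', 0 < k' & f (g i * z')%g = f z' + 
    (if pos (act z'^-1%g (a i)) then k' else - k') * cf (a i).
    by have := hf z' (a i); rewrite t_simple.
  by rewrite c0 mulr0 addr0.
case hx: (low i x).
  have hxsy : ble x (g i * y) by apply: low_le.
  have hxs : itv x y (g i * x).
    by split; [apply/step_le/lowP|apply: up_le].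
  have c0 : cf (a i) = 0.
    apply/eqP; rewrite eq_le cge0 // andbT.
    have [k' k'0 hk'] := linear_on_low hf hx.
    by have := hmax _ hxs; rewrite hk' gerDl pmulr_rle0.
  have hsub z' : itv x (g i * y) z' -> f z' = f x.
    apply: (ih _ _ _ _ hlt hf hxsy).
      by move=> z2 [h1 h2]; apply: hmax; split=> //; apply: ble_trans hsyy.
    by rewrite fs.
  case hzl: (low i z); first exact/hsub/down.
  rewrite -fs //; apply: hsub; case: hz => h1 h2; split; first exact: low_le.
  by apply: up_up_le; rewrite ?hzl.
have hsx : low i (g i * x) by rewrite low_g hx.
have hsxsy : ble (g i * x) (g i * y) by apply: up_up_le; rewrite ?hx.
have hsxx : ble (g i * x) x by apply/step_le/upP; rewrite hx.
have hup z' : itv (g i * x) (g i * y) z' -> ~~ low i z' -> itv x (g i * y) z'.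
  by case=> h1 h2 hl; split=> //; have := up_le h1 hl; rewrite gK.
have hsub z' : itv (g i * x) (g i * y) z' -> f (g i * z')%g = f x.
  have := ih _ _ _ _ hlt (linear_on_mul (g i) hf) hsxsy; rewrite !gK; apply=> //.
  move=> z2 hz2; case hl: (low i z2).
    apply: hmax; case: hz2 => h1 h2; split.
      by have := low_low_le h1 hsx hl; rewrite gK.
    by apply: up_le => //; apply: ble_trans hsyy.
  have hz3 := hup _ hz2 (negbT hl).
  have c0 : 0 <= cf (a i) by apply: cge0; case: hz3 => h1 h2; apply: ble_trans h2.
  apply: (@le_trans _ _ (f z2)).
    have [|k' k'0] := @linear_on_low f cf i (g i * z2)%g hf; first by rewrite low_g hl.
    by rewrite gK => ->; rewrite lerDl mulr_ge0 // ltW.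
  by apply: hmax; case: hz3 => h1 h2; split=> //; apply: ble_trans hsyy.
(* Here both [z] and [x] lie in [[g i * x, g i * y]]; the value at [x] gives [f (g i * x) = f x], so
   [cf (a i) = 0] and [f] is invariant under [g i]. *)
case hzl: (low i z).
  have [h1 h2] := down _ hz hzl.
  have hin : itv (g i * x) (g i * y) z by split=> //; apply: ble_trans h1.
  have hxin : itv (g i * x) (g i * y) x by split=> //; apply: ble_trans h1 h2.
  rewrite -(hsub _ hin) fs //.
  have [k' k'0] := linear_on_low hf hsx; rewrite gK (hsub _ hxin) => /eqP.
  by rewrite addrC -subr_eq subrr eq_sym mulf_eq0 gt_eqF //= => /eqP.
rewrite -(gK i z); apply: hsub; case: hz => h1 h2.
by split; apply: up_up_le; rewrite ?hx ?hzl.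
Qed.

(** Along a chain in the [w]-order [f] never decreases. A link where it stays constant has a root
    with [cf = 0], and the sign [e] of that root tells whether the untwisted step goes up or
    down. *)
Lemma max_linear f cf w e u v m : linear_on f cf ->
  (forall b, pos (act w b) -> 0 <= cf b /\ (cf b = 0 -> pos b = e)) ->
  is_max (itv u v) w m -> forall z, itv u v z ->
  f z <= f m /\ (f z = f m -> if e then ble z m else ble m z).
Proof.
move=> hf hw [_ hm] z /hm.
have -> : z = (w^-1 * (w * z))%g by rewrite mulKg.
have -> : m = (w^-1 * (w * m))%g by rewrite mulKg.
rewrite !mulVKg; elim=> [x|x x' y hs _ [h1 h2]].
  by split=> // _; case: e {hw}; apply: ble_refl.
have [b [hb hbx hx']] := step_pos hs.
have [k k0] := hf (w^-1 * x)%g (act w^-1 b); rewrite -mul_t -hx' invgM invgK actM actK hbx => hk.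
have [|c0 ce] := hw (act w^-1 b); first by rewrite actK.
have h3 : f (w^-1 * x)%g <= f (w^-1 * x')%g by rewrite hk lerDl mulr_ge0 // ltW.
split=> [|exy]; first exact: le_trans h3 h1.
have exx' : f (w^-1 * x)%g = f (w^-1 * x')%g.
  by apply/eqP; rewrite eq_le h3 exy.
have := h2 (etrans (esym exx') exy).
have pe : pos (act w^-1 b) = e.
  apply: ce; move/eqP: hk; rewrite -exx' addrC -subr_eq subrr eq_sym mulf_eq0 gt_eqF //=.
  by move/eqP.
have hadj : if e then step (w^-1 * x) (w^-1 * x') else step (w^-1 * x') (w^-1 * x).
  have := step_t_total (w^-1 * x) (act w^-1 b).
  rewrite -mul_t -hx' => -[hst|hst]; case: e pe {hw h2 ce} => pe //.
    move: hst; rewrite hx' => /step_mulP; rewrite hbx pe; done.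
  suff : step (w^-1 * x) (w^-1 * x') by move=> /step_irrefl; case; apply: step_le.
  by rewrite hx'; apply/step_mulP; rewrite hbx pe.
case: e hadj {hw h2 ce pe} => /step_le h4 h5; exact: ble_trans h5 || exact: ble_trans h4.
Qed.

End SignedGroup.

Lemma mx_ext (R : nzRingType) (p q : nat) (A B : 'M[R]_(p, q)) :
  (forall v : 'cV_q, A *m v = B *m v) -> A = B.
Proof.
move=> h; apply/matrixP => i j.
by have /matrixP/(_ i 0) := h (delta_mx j 0); rewrite -!colE !mxE.
Qed.

(** * The geometric representation *)

Section Reflections.
Variables (R : realType) (n : nat) (m : 'I_n -> 'I_n -> nat).
Hypothesis hm : coxeter_matrix m.

Local Notation Phi := (cox_form R m).
Local Notation B := (ip m).
Local Notation al := (sroot R).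
Local Notation sg := (sgen R m).

Lemma ipDr u v w : B u (v + w) = B u v + B u w :> R.
Proof. by rewrite /ip mulmxDr mxE. Qed.

Lemma ipZr u k v : B u (k *: v) = k * B u v :> R.
Proof. by rewrite /ip -scalemxAr mxE. Qed.

Lemma ipC u v : B u v = B v u :> R.
Proof.
have sym : Phi^T = Phi.
  by apply/matrixP => i j; rewrite !mxE; have [-> _] := hm.
by rewrite /ip -[in LHS](trmxK (_ *m _ *m _)) mxE !trmx_mul sym trmxK mulmxA.
Qed.

Lemma ipDl u v w : B (v + w) u = B v u + B w u :> R.
Proof. by rewrite ipC ipDr !(ipC u). Qed.

Lemma ipZl u k v : B (k *: v) u = k * B v u :> R.
Proof. by rewrite ipC ipZr (ipC u). Qed.

Lemma ipNr u v : B u (- v) = - B u v :> R.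
Proof. by rewrite -scaleN1r ipZr mulN1r. Qed.

Lemma ip_simple s t : B (al s) (al t) = Phi s t.
Proof. by rewrite /ip /sroot trmx_delta -rowE -colE !mxE. Qed.

Lemma ip_simple_self s : B (al s) (al s) = 1.
Proof.
have [_ [h _]] := hm.
by rewrite ip_simple mxE h /= divr1 cospi opprK.
Qed.

(** This is the orthogonal reflection only for [b] of norm 1, as all roots are. *)
Definition refl (b : 'cV[R]_n) : 'M[R]_n := 1%:M - 2%:R *: (b *m b^T *m Phi).

Lemma reflE b v : refl b *m v = v - (2 * B b v) *: b.
Proof.
rewrite /refl mulmxBl mul1mx -scalemxAl -!mulmxA.
by rewrite [b^T *m _]mx11_scalar mul_mx_scalar scalerA mulmxA.
Qed.

Lemma sgenE s v : sg s *m v = v - (2 * B (al s) v) *: al s.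
Proof. exact: reflE. Qed.

Lemma sgenK s : sg s *m sg s = 1%:M.
Proof.
apply: mx_ext => v; rewrite -mulmxA mul1mx !sgenE.
rewrite -!scaleNr ipDr ipZr ip_simple_self -addrA -scalerDl.
by rewrite [X in _ + X *: _](_ : _ = 0) ?scale0r ?addr0 //; ring.
Qed.

Lemma sgen_simple s : sg s *m al s = - al s.
Proof.
by rewrite sgenE ip_simple_self mulr1 scaler_nat mulr2n opprD addrA subrr sub0r.
Qed.

Lemma ip_sgen s u v : B (sg s *m u) (sg s *m v) = B u v.
Proof.
rewrite !sgenE -!scaleNr !(ipDl, ipDr, ipZl, ipZr) ip_simple_self (ipC u (al s)).
ring.
Qed.

(** * Words, the Coxeter group and its length function *)

Lemma wordM_cat ws ws' : wordM R m (ws ++ ws') = wordM R m ws *m wordM R m ws'.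
Proof. by elim: ws => [|s ws ih] /=; rewrite ?mul1mx // ih mulmxA. Qed.

Lemma wordM_revK ws : wordM R m (rev ws) *m wordM R m ws = 1%:M.
Proof.
elim: ws => [|s ws ih] /=; first by rewrite mul1mx.
by rewrite rev_cons -cats1 wordM_cat /= mulmx1 -!mulmxA (mulmxA (sg s)) sgenK mul1mx.
Qed.

Lemma wordMK_rev ws : wordM R m ws *m wordM R m (rev ws) = 1%:M.
Proof. by have := wordM_revK (rev ws); rewrite revK. Qed.

Lemma ip_wordM ws u v : B (wordM R m ws *m u) (wordM R m ws *m v) = B u v.
Proof.
by elim: ws => [|s ws ih] /=; rewrite ?mul1mx // -!mulmxA ip_sgen.
Qed.


(** The proof argument is kept in the type so that the group instance, whose inverses need the
    generators to be involutions, can be attached to it. *)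
Definition coxW of coxeter_matrix m := {w : 'M[R]_n | `[< inW m w >]}.
Local Notation W := (coxW hm).
HB.instance Definition _ := Choice.on W.

Lemma coxW_inW (x : W) : inW m (val x).
Proof. exact/asboolP/(valP x). Qed.

Definition coxW_of w (h : inW m w) : W := exist _ w (asboolT h).

Lemma inW_one : @inW R n m 1%:M.
Proof. by exists [::]. Qed.

Lemma inW_mul w w' : @inW R n m w -> inW m w' -> inW m (w *m w').
Proof. by move=> [ws ->] [ws' ->]; exists (ws ++ ws'); rewrite wordM_cat. Qed.

Lemma inW_inv w : @inW R n m w -> exists2 w', inW m w' & w' *m w = 1%:M.
Proof.
by move=> [ws ->]; exists (wordM R m (rev ws)); [exists (rev ws)|apply: wordM_revK].
Qed.

Lemma inW_gen s : inW m (sg s).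
Proof. by exists [:: s]; rewrite /= mulmx1. Qed.

Definition cox_one : W := coxW_of inW_one.
Definition cox_mul (x y : W) : W := coxW_of (inW_mul (coxW_inW x) (coxW_inW y)).
Definition cox_gen s : W := coxW_of (inW_gen s).

Lemma cox_inv_subproof (x : W) : exists y, cox_mul y x = cox_one.
Proof.
have [w' h' e] := inW_inv (coxW_inW x); exists (coxW_of h').
exact: val_inj.
Qed.
Definition cox_inv (x : W) : W := projT1 (cid (cox_inv_subproof x)).

Lemma cox_mulA : associative cox_mul.
Proof. by move=> x y z; apply: val_inj; rewrite /= mulmxA. Qed.
Lemma cox_mul1 : left_id cox_one cox_mul.
Proof. by move=> x; apply: val_inj; rewrite /= mul1mx. Qed.
Lemma cox_mulx1 : right_id cox_one cox_mul.
Proof. by move=> x; apply: val_inj; rewrite /= mulmx1. Qed.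
Lemma cox_mulV : left_inverse cox_one cox_inv cox_mul.
Proof. by move=> x; rewrite /cox_inv; case: cid. Qed.
Lemma cox_mulxV : right_inverse cox_one cox_inv cox_mul.
Proof.
move=> x; apply: val_inj; apply: mulmx1C.
by rewrite -[_ *m _]/(val (cox_mul (cox_inv x) x)) cox_mulV.
Qed.

HB.instance Definition _ :=
  isGroup.Build W cox_mulA cox_mul1 cox_mulx1 cox_mulV cox_mulxV.

Local Notation g := cox_gen.

Lemma val_mul (x y : W) : val (x * y)%g = val x *m val y.
Proof. by []. Qed.

Lemma gen_sq s : (g s * g s)%g = 1%g.
Proof. by apply: val_inj; apply: sgenK. Qed.

Lemma gen_inv s : (g s)^-1%g = g s.
Proof. exact/mulg1_eq/gen_sq. Qed.

Lemma mulgenK s (x : W) : (x * g s * g s)%g = x.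
Proof. by rewrite -mulgA gen_sq mulg1. Qed.

Definition word ws : W := foldr (fun s x => (g s * x)%g) 1%g ws.

Lemma val_word ws : val (word ws) = wordM R m ws.
Proof. by elim: ws => //= s ws <-. Qed.

Lemma word_cat ws ws' : word (ws ++ ws') = (word ws * word ws')%g.
Proof. by apply: val_inj; rewrite val_mul !val_word wordM_cat. Qed.

Lemma word_rev ws : word (rev ws) = (word ws)^-1%g.
Proof.
apply/esym/mulg1_eq/val_inj; rewrite val_mul !val_word; exact: wordMK_rev.
Qed.

Lemma wordP (x : W) : exists ws, x = word ws.
Proof.
by have [ws e] := coxW_inW x; exists ws; apply: val_inj; rewrite val_word.
Qed.

Lemma has_length_exists (x : W) : exists k, has_length m (val x) k.
Proof.
have hex : exists k, `[< exists ws, val x = wordM R m ws /\ size ws = k >].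
  by have [ws e] := coxW_inW x; exists (size ws); apply/asboolP; exists ws.
exists (ex_minn hex); case: ex_minnP => k /asboolP h hmin; split=> // ws e.
by apply: hmin; apply/asboolP; exists ws.
Qed.

Definition len (x : W) : nat := projT1 (cid (has_length_exists x)).

Lemma len_has_length x : has_length m (val x) (len x).
Proof. by rewrite /len; case: cid. Qed.

Lemma len_word ws : (len (word ws) <= size ws)%N.
Proof. by have [_ h] := len_has_length (word ws); apply: h; apply: val_word. Qed.

Lemma reduced_word x : exists2 ws, x = word ws & size ws = len x.
Proof.
have [[ws [e h]] _] := len_has_length x.
by exists ws => //; apply: val_inj; rewrite val_word.
Qed.

Lemma len_mulgen x s : (len (x * g s)%g <= (len x).+1)%N.
Proof.
have [ws -> <-] := reduced_word x; rewrite -[g s]mulg1 -[(g s * 1)%g]/(word [:: s]).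
by rewrite -word_cat; apply: leq_trans (len_word _) _; rewrite size_cat addn1.
Qed.

(** * Dihedral subgroups and the braid relation *)

(* Alternating product of [k] generators whose last (rightmost) factor is [g t]. *)
Fixpoint alt s t k : W :=
  if k is k'.+1 then (g (if odd k' then s else t) * alt s t k')%g else 1%g.

Lemma alt_right s t k : alt s t k.+1 = (alt t s k * g t)%g.
Proof.
elim: k => [|k ih]; first by rewrite /= mulg1 mul1g.
rewrite [LHS](_ : _ = (g (if odd k.+1 then s else t) * alt s t k.+1)%g) // ih /=.
by rewrite mulgA; case: (odd k).
Qed.

Lemma len_mul_alt x s t k : (len (x * alt s t k)%g <= len x + k)%N.
Proof.
elim: k s t => [|k ih] s t; first by rewrite mulg1 addn0.
rewrite alt_right mulgA addnS; apply: leq_trans (len_mulgen _ _) _.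
by rewrite ltnS ih.
Qed.

Lemma sgen_alt s t : sg t *m al s = al s - (2 * B (al s) (al t)) *: al t.
Proof. by rewrite sgenE ipC. Qed.

(** Each further generator changes only one of the two coordinates, by this recursion. An arbitrary
    solution [U] covers both the sine quotients and the infinite bond, where [U k] is [k]. *)
Lemma alt_act s t (U : nat -> R) : U 0%N = 0 -> U 1%N = 1 ->
  (forall k, U k.+2 = - (2 * B (al s) (al t)) * U k.+1 - U k) ->
  forall k, val (alt s t k) *m al s =
    U (if odd k then k else k.+1) *: al s + U (if odd k then k.+1 else k) *: al t.
Proof.
move=> U0 U1 US; elim=> [|k ih].
  by rewrite /= U0 U1 mul1mx scale1r scale0r addr0.
rewrite val_mul -mulmxA ih mulmxDr -!scalemxAr /=.
case: (odd k) => /=; rewrite US sgen_simple; [rewrite sgen_alt ipC|rewrite sgen_alt];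
  apply/matrixP => i j; rewrite !mxE; ring.
Qed.

(* The images of alpha_s under alternating words in s, t have these coordinates
   on alpha_s and alpha_t, where M = m s t. *)
Definition dihedral_coef (M : nat) (k : nat) : R := sin (k%:R * (pi / M%:R)) / sin (pi / M%:R).

Lemma sin_angle_gt0 M : (1 < M)%N -> 0 < sin (pi / M%:R) :> R.
Proof.
move=> hM; have M0 : 0 < M%:R :> R by rewrite ltr0n; lia.
apply: sin_gt0_pi; rewrite divr_gt0 ?pi_gt0 //= ltr_pdivrMr // ltr_pMr ?pi_gt0 //.
by rewrite ltr1n.
Qed.

Lemma dihedral_coef_rec M k : (1 < M)%N ->
  dihedral_coef M k.+2 = 2 * cos (pi / M%:R) * dihedral_coef M k.+1 - dihedral_coef M k.
Proof.
move=> hM; have s0 := lt0r_neq0 (sin_angle_gt0 hM); rewrite /dihedral_coef.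
set th := pi / _ in s0 *.
have -> : k.+2%:R * th = k.+1%:R * th + th by rewrite -(addn1 k.+1) natrD mulrDl mul1r.
have -> : k%:R * th = k.+1%:R * th - th by rewrite -(addn1 k) natrD mulrDl mul1r addrK.
by rewrite sinD sinB; field.
Qed.

Lemma dihedral_coef0 M : dihedral_coef M 0 = 0.
Proof. by rewrite /dihedral_coef mul0r sin0 mul0r. Qed.

Lemma dihedral_coef1 M : (1 < M)%N -> dihedral_coef M 1 = 1.
Proof. by move=> /sin_angle_gt0 /lt0r_neq0 h; rewrite /dihedral_coef mul1r divff. Qed.

Lemma dihedral_coef_ge0 M k : (1 < M)%N -> (k <= M)%N -> 0 <= dihedral_coef M k.
Proof.
move=> hM hk; apply: divr_ge0; last exact/ltW/sin_angle_gt0.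
have M0 : 0 < M%:R :> R by rewrite ltr0n; lia.
apply: sin_ge0_pi; rewrite mulr_ge0 ?divr_ge0 ?pi_ge0 ?ler0n //=.
by rewrite mulrA ler_pdivrMr // mulrC ler_pM2l ?pi_gt0 // ler_nat.
Qed.

Lemma dihedral_coef_M M : (1 < M)%N -> dihedral_coef M M = 0.
Proof.
move=> hM; rewrite /dihedral_coef mulrC mulrCA mulrA -mulrA divff ?mulr1; last first.
  by rewrite pnatr_eq0; lia.
by rewrite sinpi mulr0.
Qed.

Lemma simple_angle s t : s != t -> m s t != 0%N ->
  B (al s) (al t) = - cos (pi / (m s t)%:R).
Proof. by move=> hst h0; rewrite ip_simple mxE (negbTE h0). Qed.

Lemma simple_angle_m s t : s != t -> m s t != 0%N -> (1 < m s t)%N.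
Proof.
by move=> hst h0; have [_ [_ /(_ s t hst)]] := hm; case: (m s t) h0 => [|[]].
Qed.

Lemma m_sym s t : m s t = m t s.
Proof. by have [h _] := hm. Qed.

Lemma alt_fixed s t k v : B (al s) v = 0 -> B (al t) v = 0 ->
  val (alt s t k) *m v = v.
Proof.
move=> hs ht; elim: k => [|k ih]; first by rewrite mul1mx.
rewrite val_mul -mulmxA ih /= sgenE.
by case: (odd k); rewrite ?hs ?ht mulr0 scale0r subr0.
Qed.

Lemma dihedral_coefE s t k : s != t -> m s t != 0%N ->
  let U := dihedral_coef (m s t) in
  val (alt s t k) *m al s =
    U (if odd k then k else k.+1) *: al s + U (if odd k then k.+1 else k) *: al t.
Proof.
move=> hst h0 U; have h1 := simple_angle_m hst h0.
apply: alt_act; [exact: dihedral_coef0|exact: dihedral_coef1|].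
move=> j; rewrite /U dihedral_coef_rec // simple_angle //; ring.
Qed.

(** Both sides are [- al t] for odd [m s t] and [- al s] for even: the coefficients at [m s t - 1],
    [m s t] and [m s t + 1] are 1, 0 and -1. *)
Lemma alt_braid_simple s t : s != t -> m s t != 0%N ->
  val (alt s t (m s t)) *m al s = val (alt t s (m s t)) *m al s.
Proof.
move=> hst h0; have h1 := simple_angle_m hst h0.
have := dihedral_coefE (m s t) hst h0; have := dihedral_coefE (m s t).-1 hst h0.
have := dihedral_coef_M h1; have := dihedral_coef_rec (m s t).-1 h1.
set U := dihedral_coef (m s t).
have U1 : U (m s t).-1 = 1.
  rewrite /U /dihedral_coef [X in sin X / _](_ : _ = pi - pi / (m s t)%:R); last first.
    have : (m s t)%:R != 0 :> R by rewrite pnatr_eq0.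
    rewrite -subn1 natrB; last by lia.
    by move=> ?; field.
  rewrite sinB sinpi cospi mul0r sub0r mulN1r opprK divff //.
  exact/lt0r_neq0/sin_angle_gt0.
case: (m s t) h1 h0 U U1 => [//|[//|M]] _ _ U U1 US U0 e1 e2.
rewrite e2 alt_right.
rewrite val_mul -mulmxA [val (g s)]/(sg s) sgen_simple mulmxN e1 /=.
by case: (odd M) => /=; rewrite US U0 U1; apply/matrixP => i j; rewrite !mxE; ring.
Qed.

Lemma alt_braid s t : s != t -> m s t != 0%N -> alt s t (m s t) = alt t s (m s t).
Proof.
move=> hst h0; have h1 := simple_angle_m hst h0.
apply/val_inj/mx_ext => v.
pose c := cos (pi / (m s t)%:R) : R.
have c2 : 1 - c ^+ 2 != 0.
  by rewrite -sin2cos2 expf_neq0 //; apply/lt0r_neq0/sin_angle_gt0.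
(* The form is nondegenerate on the plane of [al s] and [al t]; [x] and [y] are the coordinates of
   the projection of [v] to it, and the remainder [v'] is fixed by both generators. *)
pose x := (B (al s) v + c * B (al t) v) / (1 - c ^+ 2).
pose y := (B (al t) v + c * B (al s) v) / (1 - c ^+ 2).
pose v' := v + (- x) *: al s + (- y) *: al t.
have est : B (al s) (al t) = - c by apply: simple_angle.
have hs : B (al s) v' = 0.
  by rewrite !(ipDr, ipZr) ip_simple_self est /x /y; field.
have ht : B (al t) v' = 0.
  by rewrite !(ipDr, ipZr) ip_simple_self (ipC (al t) (al s)) est /x /y; field.
have -> : v = v' + x *: al s + y *: al t.
  by apply/matrixP => i j; rewrite !mxE; ring.
clearbody v'.
have e1 := alt_braid_simple hst h0.
have e2 : val (alt s t (m s t)) *m al t = val (alt t s (m s t)) *m al t.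
  have hts : t != s by rewrite eq_sym.
  have h0' : m t s != 0%N by rewrite m_sym.
  by have := alt_braid_simple hts h0'; rewrite (m_sym t s).
by rewrite !mulmxDr -!scalemxAr e1 e2 (alt_fixed _ hs ht) (alt_fixed _ ht hs).
Qed.

(** * Positive and negative roots *)

Definition nonneg (v : 'cV[R]_n) := [forall i, 0 <= v i 0].

Lemma nonnegP (v : 'cV[R]_n) : reflect (forall i, 0 <= v i 0) (nonneg v).
Proof. exact: forallP. Qed.

Lemma nonneg_simple s : nonneg (al s).
Proof. by apply/nonnegP => i; rewrite mxE; case: (_ && _); rewrite ?ler01. Qed.

Lemma nonnegD v w : nonneg v -> nonneg w -> nonneg (v + w).
Proof. by move=> /nonnegP hv /nonnegP hw; apply/nonnegP => i; rewrite mxE addr_ge0. Qed.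

Lemma nonnegZ k v : 0 <= k -> nonneg v -> nonneg (k *: v).
Proof. by move=> hk /nonnegP hv; apply/nonnegP => i; rewrite mxE mulr_ge0. Qed.

(* Strip alternately t, s, t, ... from the right of x while the length drops; the
   remaining factor is shorter than x and ascends under both s and t, and fewer
   than m s t letters were stripped, since otherwise the braid relation would
   make x * g s shorter than x. *)
Lemma ascent_nonneg x s : (len x <= len (x * g s)%g)%N -> nonneg (val x *m al s).
Proof.
have [k hk] := ubnP (len x); elim: k x s hk => // k ih x s hk hs.
case: (pselect (exists t, (len (x * g t)%g < len x)%N)) => [[t ht]|hn]; last first.
  have [ws] := reduced_word x; case/lastP: ws => [-> _|ws t ex e].
    by rewrite mul1mx nonneg_simple.
  case: hn; exists t; rewrite -e size_rcons ltnS ex -cats1 word_cat /= mulg1 mulgenK.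
  exact: len_word.
have hst : s != t by apply: contraTneq ht => <-; rewrite -leqNgt.
pose v j := (x * (alt s t j)^-1)%g.
have v0 : v 0%N = x by rewrite /v invg1 mulg1.
have vS j : v j.+1 = (v j * g (if odd j then s else t))%g.
  by rewrite /v /= invgM gen_inv mulgA.
have xv j : x = (v j * alt s t j)%g by rewrite /v mulgVK.
have vK j : v j = (v j.+1 * g (if odd j then s else t))%g by rewrite vS mulgenK.
(* Each of the first [j] strippings has shortened the element. *)
pose P j := (len (v j) + j <= len x)%N.
have P1 : P 1%N by rewrite /P vS v0 addn1.
have PS j : P j.+1 -> P j.
  rewrite /P addnS => h; apply: leq_trans h.
  by rewrite [in X in (X <= _)%N]vK -addSn leq_add2r len_mulgen.
have [j Pj jmax] : exists2 j, P j & forall i, P i -> (i <= j)%N.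
  have hP i : P i -> (i <= len x)%N by apply: leq_trans; apply: leq_addl.
  by case: (ex_maxnP (ex_intro P 1%N P1) hP) => j; exists j.
have Pdown i : (i <= j)%N -> P i.
  move=> hi; rewrite -(subKn hi); elim: (j - i)%N => [|d ihd]; first by rewrite subn0.
  case: (leqP j d) => hd; last by apply: PS; rewrite -subSn // subSS.
  by rewrite (_ : j - d.+1 = j - d)%N //; lia.
have j1 := jmax _ P1.
have lt_j : (len (v j) < k)%N.
  by have := Pj; rewrite /P; move: j1 hk; set a := len _; set b := len _; lia.
have hja : nonneg (val (v j) *m al (if odd j then s else t)).
  apply: ih => //; rewrite -vS leqNgt; apply/negP => h.
  have /jmax : P j.+1 by apply: leq_trans Pj; rewrite addnS -addSn leq_add2r.
  by rewrite ltnn.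
have hjb : nonneg (val (v j) *m al (if odd j then t else s)).
  apply: ih => //; have -> : (v j * g (if odd j then t else s))%g = v j.-1.
    case: j j1 {Pj jmax Pdown lt_j hja} => // j _.
    by rewrite [in RHS]vK /=; case: (odd j).
  have h1 : (len x <= len (v j.-1) + j.-1)%N by rewrite {1}(xv j.-1) len_mul_alt.
  by move: Pj h1 j1; rewrite /P; set a := len _; set b := len _; set c := len _; lia.
have [hvs hvt] : nonneg (val (v j) *m al s) /\ nonneg (val (v j) *m al t).
  by case: (odd j) hja hjb.
suff [U [U0 U1 US] [Uj Uj1]] : exists2 U : nat -> R, [/\ U 0%N = 0, U 1%N = 1 &
    forall k, U k.+2 = - (2 * B (al s) (al t)) * U k.+1 - U k] & 0 <= U j /\ 0 <= U j.+1.
  rewrite (xv j) val_mul -mulmxA (alt_act U0 U1 US) mulmxDr -!scalemxAr.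
  by apply: nonnegD; apply: nonnegZ => //; case: (odd j).
have [m0|m0] := eqVneq (m s t) 0%N.
  exists (fun i => i%:R) => //; split=> // i.
  by rewrite ip_simple mxE m0 /= -addn2 -addn1 !natrD; ring.
have h1 := simple_angle_m hst m0.
exists (dihedral_coef (m s t)).
  split; [exact: dihedral_coef0|exact: dihedral_coef1|].
  by move=> i; rewrite dihedral_coef_rec // simple_angle //; ring.
suff hj : (j < m s t)%N by rewrite !dihedral_coef_ge0 // ltnW.
rewrite ltnNge; apply/negP => /Pdown; rewrite /P.
have : (x * g s = v (m s t) * alt s t (m s t).-1)%g.
  rewrite {1}(xv (m s t)) alt_braid //; case: (m s t) m0 => // M _.
  by rewrite alt_right mulgA mulgenK.
move=> e; move: hs; rewrite e => hs.
have := leq_trans hs (len_mul_alt (v (m s t)) s t (m s t).-1).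
by move: h1; set a := len _; set b := len _; lia.
Qed.

Lemma val_mulVK (x : W) (v : 'cV[R]_n) : val x *m (val x^-1%g *m v) = v.
Proof. by rewrite mulmxA -val_mul mulgV mul1mx. Qed.

(* The pair (w, s) stands for the root w alpha_s; distinct pairs may denote the
   same root. *)
Definition root (b : W * 'I_n) : 'cV[R]_n := val b.1 *m al b.2.
Definition act (x : W) (b : W * 'I_n) : W * 'I_n := ((x * b.1)%g, b.2).
Definition tr (b : W * 'I_n) : W := (b.1 * g b.2 * b.1^-1)%g.
Definition simple (s : 'I_n) : W * 'I_n := (1%g, s).
Definition pos b := nonneg (root b).
Definition opp (b : W * 'I_n) : W * 'I_n := ((b.1 * g b.2)%g, b.2).

Lemma ip_val (x : W) u v : B (val x *m u) (val x *m v) = B u v.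
Proof. by have [ws ->] := coxW_inW x; apply: ip_wordM. Qed.

Lemma root_norm b : B (root b) (root b) = 1.
Proof. by rewrite ip_val ip_simple_self. Qed.

Lemma root_act x b : root (act x b) = val x *m root b.
Proof. by rewrite /root /= mulmxA. Qed.

Lemma root_simple s : root (simple s) = al s.
Proof. exact: mul1mx. Qed.

Lemma root_opp b : root (opp b) = - root b.
Proof. by rewrite /root /= -mulmxA sgen_simple mulmxN. Qed.

Lemma ip0r u : B u 0 = 0 :> R.
Proof. by rewrite -(scale0r 0) ipZr mul0r. Qed.

(** For a pair [(x, s)], [ascent_nonneg] applies to [x] or to [x * g s], so the root or its opposite
    is nonnegative; having norm 1, it cannot be both. *)
Lemma pos_oppE b : pos (opp b) = ~~ pos b.
Proof.
case hb: (pos b) => /=.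
  apply/negP => h; have : B (root b) (root b) = 1 := root_norm b.
  suff -> : root b = 0 by rewrite ip0r => /esym/eqP; rewrite oner_eq0.
  apply/matrixP => i j; rewrite ord1 [RHS]mxE; apply/eqP.
  rewrite eq_le (nonnegP _ hb) andbT -oppr_ge0.
  by have := nonnegP _ h i; rewrite root_opp mxE.
case: b hb => x s hb; have [h|h] := leqP (len x) (len (x * g s)%g).
  by move: hb; rewrite /pos ascent_nonneg.
by apply: ascent_nonneg; rewrite /= mulgenK ltnW.
Qed.

Lemma act1 b : act 1%g b = b.
Proof. by rewrite /act mul1g -surjective_pairing. Qed.

Lemma actM x y b : act (x * y)%g b = act x (act y b).
Proof. by rewrite /act mulgA. Qed.

Lemma act_opp x b : act x (opp b) = opp (act x b).
Proof. by rewrite /act /opp /= mulgA. Qed.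

Lemma act_tr b : act (tr b) b = opp b.
Proof. by rewrite /act /tr /opp mulgVK. Qed.

Lemma tr_opp b : tr (opp b) = tr b.
Proof. by rewrite /tr /= invgM gen_inv !mulgA mulgenK. Qed.

Lemma tr_act x b : tr (act x b) = (x * tr b * x^-1)%g.
Proof. by rewrite /tr /= invgM !mulgA. Qed.

Lemma tr_sq b : (tr b * tr b)%g = 1%g.
Proof.
by rewrite /tr !mulgA mulgVK mulgenK mulgV.
Qed.

Lemma tr_simple s : tr (simple s) = g s.
Proof. by rewrite /tr /= invg1 mulg1 mul1g. Qed.

Lemma val_tr b : val (tr b) = refl (root b).
Proof.
apply: mx_ext => v; rewrite reflE /tr !val_mul -!mulmxA.
set u := val _ *m v; have -> : v = val b.1 *m u by rewrite val_mulVK.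
by rewrite ip_val sgenE mulmxBr -scalemxAr.
Qed.

Lemma sgen_coord i j (v : 'cV[R]_n) : j != i -> (sg i *m v) j 0 = v j 0.
Proof.
by move=> /negbTE hj; rewrite sgenE 3!mxE [X in _ * X]mxE hj mulr0 oppr0 addr0.
Qed.

(** [g i] alters only coordinate [i], so a positive root made negative is a nonnegative multiple of
    [al i], and norm 1 makes it [al i]. *)
Lemma pos_gen_nonneg i b : tr b <> g i -> pos b -> pos (act (g i) b).
Proof.
move=> hne hb; case h: (pos (act (g i) b)) => //; case: hne.
have /nonnegP h1 := hb; have /nonnegP h2 : pos (opp (act (g i) b)) by rewrite pos_oppE h.
have root_j j : j != i -> root b j 0 = 0.
  move=> hj; apply/eqP; rewrite eq_le h1 andbT -oppr_ge0.
  by have := h2 j; rewrite root_opp root_act mxE sgen_coord.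
have e : root b = root b i 0 *: al i.
  apply/matrixP => j k; rewrite ord1 [RHS]mxE [X in _ * X]mxE eqxx andbT.
  by have [->|/root_j] := eqVneq j i; rewrite ?mulr1 ?mulr0.
apply: val_inj; rewrite val_tr.
suff -> : root b = al i by [].
have := root_norm b; rewrite e ipZl ipZr ip_simple_self mulr1 -expr2 => /eqP.
by rewrite sqrp_eq1 // => /eqP ->; rewrite scale1r.
Qed.

Lemma pos_gen i b : tr b <> g i -> pos (act (g i) b) = pos b.
Proof.
move=> hne; case hb: (pos b); first exact: pos_gen_nonneg.
apply/negbTE; rewrite -pos_oppE -act_opp; apply: pos_gen_nonneg; first by rewrite tr_opp.
by rewrite pos_oppE hb.
Qed.

(** * Strong exchange and length *)

(** The root is moved through the word from the left. Its sign can change only at a letter equal to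
    the current reflection, and that letter is deleted. *)
Lemma strong_exchange ws b : pos (act (word ws)^-1%g b) != pos b ->
  exists2 ws', (tr b * word ws)%g = word ws' & (size ws' < size ws)%N.
Proof.
elim: ws b => [|s ws ih] b; first by rewrite invg1 act1 eqxx.
have [e _|/eqP hne] := eqVneq (tr b) (g s).
  by exists ws; rewrite // e /= mulgA gen_sq mul1g.
rewrite /= invgM gen_inv -(pos_gen hne) => h.
have [|ws' e hs] := ih (act (g s) b); first by rewrite -actM.
exists (s :: ws') => //=; rewrite -e tr_act gen_inv !mulgA gen_sq mul1g //.
Qed.

Lemma len_tr x b : pos (act x^-1%g b) = pos b -> (len x < len (tr b * x)%g)%N.
Proof.
move=> h; have [ws e hs] := reduced_word (tr b * x)%g.
have [|ws' e' hlt] := @strong_exchange ws b.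
  have trV : (tr b)^-1%g = tr b := mulg1_eq (tr_sq b).
  by rewrite -e invgM trV actM act_tr act_opp pos_oppE h; case: (pos b).
move: e'; rewrite -e mulgA tr_sq mul1g => ex.
by rewrite -hs ex; apply: leq_ltn_trans (len_word _) _.
Qed.

Lemma gen_ind (P : W -> Prop) :
  P 1%g -> (forall i x, P x -> P (g i * x)%g) -> forall x, P x.
Proof. by move=> h0 hS x; have [ws ->] := wordP x; elim: ws => //= s ws; apply: hS. Qed.

Lemma pos_act_tr b : pos (act (tr b) b) = ~~ pos b.
Proof. by rewrite act_tr pos_oppE. Qed.

Lemma pos_simple s : pos (simple s).
Proof. by rewrite /pos root_simple nonneg_simple. Qed.

Lemma ip_sum u v : B u v = \sum_j v j 0 * B u (al j).
Proof.
rewrite /ip mxE; apply: eq_bigr => j _; rewrite mulrC; congr (_ * _).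
by rewrite /sroot -colE [RHS]mxE.
Qed.

Lemma root_neq0 b : root b <> 0.
Proof. by move=> e; have := root_norm b; rewrite e ip0r => /esym/eqP; rewrite oner_eq0. Qed.

(** * Agreement with the Bruhat order on matrices *)

Local Notation step := (step act tr pos).
Local Notation ble := (ble act tr pos).
Local Notation itv := (itv act tr pos).

(** [step] multiplies by a reflection on the left, [bruhat_step] on the right; conjugation by [x]
    passes from one to the other. *)
Lemma bruhat_step_val (x y : W) : step x y -> bruhat_step m (val x) (val y).
Proof.
move=> hxy; have hlt := step_len len_tr hxy; case: hxy => b hb hy.
split; first exact: coxW_inW.
exists (val (tr (act x^-1%g b))); split; last split.
- have [ws e] := wordP (act x^-1%g b).1; exists ws, b.2.
  by rewrite /tr e -word_rev !val_mul !val_word.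
- by rewrite hy tr_act invgK -val_mul !mulgA mulgV mul1g.
exists (len x), (len y); split; first exact: len_has_length.
by split; first exact: len_has_length.
Qed.

Lemma has_length_len (x : W) k : has_length m (val x) k -> k = len x.
Proof.
move=> [[ws [e hs]] hk]; have [[ws' [e' hs']] hk'] := len_has_length x.
by apply/eqP; rewrite eqn_leq -{1}hs' -[in X in _ && X]hs hk // hk'.
Qed.

Lemma bruhat_step_inv (x : W) Y : bruhat_step m (val x) Y -> exists2 y : W, Y = val y & step x y.
Proof.
move=> [_ [t [[ws [s et]] [eY [kx [ky [hx [hy hlt]]]]]]]].
pose b : W * 'I_n := ((x * word ws)%g, s).
have eb : (tr b * x = x * (word ws * g s * word (rev ws)))%g.
  by rewrite /tr /= word_rev invgM !mulgA mulgVK.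
have eY' : Y = val (tr b * x)%g by rewrite eb eY et !val_mul !val_word.
exists (tr b * x)%g => //; rewrite eY' in hy.
case: (step_t_total actM tr_act tr_sq pos_act_tr len_tr x b) => // /(step_len len_tr).
by rewrite -(has_length_len hx) -(has_length_len hy) => /(ltn_trans hlt); rewrite ltnn.
Qed.

Lemma bruhat_le_inv X Y : bruhat_le m X Y ->
  forall x : W, X = val x -> exists2 y : W, Y = val y & ble x y.
Proof.
elim=> {X Y} [X _ x ->|X Y Z h _ ih x eX]; first by exists x => //; apply: ble_refl.
rewrite eX in h; have [y /ih [z -> hz] hxy] := bruhat_step_inv h.
by exists z => //; apply: ble_cons hz.
Qed.

Lemma bruhat_leP (x y : W) : bruhat_le m (val x) (val y) <-> ble x y.
Proof.
split=> [/bruhat_le_inv /(_ x erefl) [z /val_inj -> //]|].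
elim=> {x y} [x|x x' y /bruhat_step_val h _]; last exact: bruhat_trans.
by apply: bruhat_refl; apply: coxW_inW.
Qed.

(** * Heights and dominant chambers *)

Section Antidominant.
Variable p : 'cV[R]_n.
Hypothesis hp : forall s, B p (al s) < 0.

Lemma ip_p_neg b : pos b -> B p (root b) < 0.
Proof.
move=> /nonnegP hb; have hterm j : 0 <= - (root b j 0 * B p (al j)).
  by rewrite oppr_ge0 mulr_ge0_le0 // ltW.
rewrite ip_sum lt_neqAle -oppr_ge0 -sumrN sumr_ge0 // andbT.
rewrite -oppr_eq0 -sumrN; apply/eqP => /psumr_eq0P h0.
apply: (@root_neq0 b); apply/matrixP => j k; rewrite ord1 [RHS]mxE.
have /eqP := h0 (fun j _ => hterm j) j isT.
by rewrite oppr_eq0 mulf_eq0 (lt_eqF (hp j)) orbF => /eqP.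
Qed.

Lemma ip_p_pos b : ~~ pos b -> 0 < B p (root b).
Proof. by rewrite -pos_oppE => /ip_p_neg; rewrite root_opp ipNr oppr_lt0. Qed.

Definition height (c : 'rV[R]_n) (x : W) : R := (c *m (val x *m p)) 0 0.
Definition slope (c : 'rV[R]_n) b : R := (c *m root b) 0 0.

(** Reflecting [val x *m p] in [root b] subtracts [k] times that root, and antidominance of [p]
    gives [k] the sign opposite to that of [act x^-1 b]. *)
Lemma height_linear c : linear_on act tr pos (height c) (slope c).
Proof.
move=> x b; set k := 2 * B p (root (act x^-1%g b)).
have hk : B (root b) (val x *m p) = B p (root (act x^-1%g b)).
  by rewrite root_act -[in RHS](ip_val x) val_mulVK ipC.
have e : height c (tr b * x)%g = height c x - k * slope c b.
  rewrite /height val_mul -mulmxA val_tr reflE mulmxBr -scalemxAr mxE [X in _ + X]mxE.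
  by rewrite [in X in _ - X]mxE hk.
case h: (pos _).
  by exists (- k); rewrite ?e ?mulNr // oppr_gt0 pmulr_rlt0 ?ip_p_neg.
by exists k; rewrite ?e ?mulNr // mulr_gt0 // ip_p_pos ?h.
Qed.

Lemma slope_act c x b : slope c (act x b) =
  \sum_j root b j 0 * slope c (act x (simple j)).
Proof.
have h v : (c *m (val x *m v)) 0 0 = \sum_j v j 0 * (c *m (val x *m al j)) 0 0.
  rewrite mulmxA mxE; apply: eq_bigr => j _.
  by rewrite mulrC /sroot [in RHS]mulmxA -colE [col _ _ _ _]mxE.
by rewrite /slope root_act h; apply: eq_bigr => j _; rewrite root_act root_simple.
Qed.

Lemma argmin_seq (T : eqType) (l : seq T) (P : T -> Prop) (f : T -> R) :
  (exists2 x, x \in l & P x) ->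
  exists2 x, P x & forall y, y \in l -> P y -> f x <= f y.
Proof.
elim: l => [[x //]|a l ih hex].
case: (pselect (exists2 x, x \in l & P x)) => [/ih [x hx hmin]|hn]; last first.
  have ha : P a.
    by case: hex => x; rewrite inE => /orP [/eqP -> //|hx hP]; case: hn; exists x.
  exists a => // y; rewrite inE => /orP [/eqP -> //|hy hP].
  by case: hn; exists y.
case: (pselect (P a /\ f a < f x)) => [[ha hlt]|hna].
  exists a => // y; rewrite inE => /orP [/eqP -> //|hy hP].
  exact/ltW/(lt_le_trans hlt)/hmin.
exists x => // y; rewrite inE => /orP [/eqP -> ha|]; last exact: hmin.
by rewrite leNgt; apply/negP => hlt; apply: hna.
Qed.

Variable lW : seq W.
Hypothesis lWP : forall x, x \in lW.

(** [w] minimizes [height c] of its inverse, then [height c2]. Comparison with [g r * w] gives the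
    signs of both slopes on the simple roots of the chamber, and positive combinations give the
    rest. *)
Lemma lex_dominant c e : exists w, forall b, pos (act w b) ->
  0 <= slope c b /\ (slope c b = 0 -> pos b = e).
Proof.
(* This functional vanishes on no root and is positive exactly on those with [pos b = e]. *)
pose c2 : 'rV[R]_n := if e then - (p^T *m Phi) else p^T *m Phi.
have [|w1 _ hw1] := @argmin_seq _ lW (fun=> True) (fun x => height c x^-1%g).
  by exists 1%g.
have [|w hw hw2] := @argmin_seq _ lW (fun x => height c x^-1%g = height c w1^-1%g)
   (fun x => height c2 x^-1%g).
  by exists w1.
have hsim c' r : exists2 k, 0 < k &
    height c' (g r * w)^-1%g = height c' w^-1%g + k * slope c' (act w^-1%g (simple r)).
  have [k k0] := height_linear c' w^-1%g (act w^-1%g (simple r)).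
  rewrite -actM invgK mulgV act1 pos_simple tr_act tr_simple mulgVK => hk.
  by exists k; rewrite // invgM gen_inv.
have hc r : 0 <= slope c (act w^-1%g (simple r)).
  have [k k0 hk] := hsim c r; have := hw1 (g r * w)%g (lWP _) I.
  by rewrite hk -hw lerDl pmulr_rge0.
have hc2 r : slope c (act w^-1%g (simple r)) = 0 -> 0 <= slope c2 (act w^-1%g (simple r)).
  move=> h0; have [k k0 hk] := hsim c r; have [k' k'0 hk'] := hsim c2 r.
  have := hw2 (g r * w)%g (lWP _); rewrite hk h0 mulr0 addr0 => /(_ hw).
  by rewrite hk' lerDl pmulr_rge0.
exists w => b0; set b := act w b0; have -> : b0 = act w^-1%g b.
  by rewrite /b -actM mulVg act1.
move=> {}/nonnegP hb; have hterm j : 0 <= root b j 0 * slope c (act w^-1%g (simple j)).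
  by rewrite mulr_ge0.
rewrite slope_act; split; first by apply: sumr_ge0 => j _; apply: hterm.
move=> /psumr_eq0P h0.
have h2 : 0 <= slope c2 (act w^-1%g b).
  rewrite slope_act; apply: sumr_ge0 => j _.
  have /eqP := h0 (fun j _ => hterm j) j isT.
  by rewrite mulf_eq0 => /orP [/eqP ->|/eqP /hc2 h]; rewrite ?mul0r // mulr_ge0.
have hs v : (c2 *m v) 0 0 = if e then - B p v else B p v.
  by rewrite /c2 /ip; case: e {hw2 hc2 c2 h2}; rewrite ?mulNmx ?mxE.
move: h2; rewrite /slope hs; case: e {c2 hw2 hc2 hs}.
  rewrite oppr_ge0; case: (boolP (pos _)) => // /ip_p_pos h h'.
  by have := lt_le_trans h h'; rewrite ltxx.
case: (boolP (pos _)) => // /ip_p_neg h h'.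
by have := lt_le_trans h h'; rewrite ltxx.
Qed.

(** * Convex hulls and faces *)

Lemma conv_bound (A : set 'cV[R]_n) (c : 'rV[R]_n) M q :
  (forall a, A a -> (c *m a) 0 0 <= M) -> conv A q -> (c *m q) 0 0 <= M.
Proof.
move=> hA [k [a [l [ha [hl [hsum ->]]]]]].
rewrite mulmx_sumr summxE -[M]mul1r -hsum mulr_suml; apply: ler_sum => i _.
by rewrite -scalemxAr mxE ler_wpM2l // hA.
Qed.

Lemma sub_conv (A : set 'cV[R]_n) q : A q -> conv A q.
Proof.
move=> h; exists 1%N, (fun=> q), (fun=> 1); rewrite !big_ord1 scale1r.
by split=> //; split=> // _; exact: ler01.
Qed.

(** A combination reaching the bound has positive weight only on points reaching it; points of
    weight zero are replaced by [a0], since [conv] asks every listed point to lie in the set. *)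
Lemma conv_face (A A' : set 'cV[R]_n) (c : 'rV[R]_n) M a0 q : A' a0 ->
  (forall a, A a -> (c *m a) 0 0 <= M) ->
  (forall a, A a -> (c *m a) 0 0 = M -> A' a) ->
  conv A q -> M <= (c *m q) 0 0 -> conv A' q.
Proof.
move=> ha0 hA hA' [k [a [l [ha [hl [hsum eq]]]]]] hM.
have hterm i : 0 <= l i * (M - (c *m a i) 0 0) by rewrite mulr_ge0 // subr_ge0 hA.
have h0 : \sum_(i < k) l i * (M - (c *m a i) 0 0) = 0.
  apply/eqP; rewrite eq_le sumr_ge0 // andbT.
  under eq_bigr => i _ do rewrite mulrBr.
  rewrite sumrB -mulr_suml hsum mul1r subr_le0.
  suff <- : (c *m q) 0 0 = \sum_(i < k) l i * (c *m a i) 0 0 by [].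
  rewrite eq mulmx_sumr summxE; apply: eq_bigr => i _.
  by rewrite -scalemxAr mxE.
move/psumr_eq0P: h0 => h0.
exists k, (fun i => if l i == 0 then a0 else a i), l; split=> [i|].
  case: eqP => // /eqP hli; apply: hA' => //.
  have /eqP := h0 (fun i _ => hterm i) i isT.
  by rewrite mulf_eq0 (negbTE hli) subr_eq0 => /eqP.
split=> //; split=> //; rewrite eq; apply: eq_bigr => i _.
by case: eqP => // ->; rewrite !scale0r.
Qed.

Lemma face_itv (u v : W) F : ble u v -> is_face (BIP m (val u) (val v) p) F ->
  exists x y : W, [/\ ble u x, ble x y, ble y v & F = BIP m (val x) (val y) p].
Proof.
move=> huv [c ->].
have lenK x : (len x <= \max_(y <- lW) len y)%N by exact: leq_bigmax_seq.
have hmat := matroid_itv act1 actM tr_act tr_simple tr_sq pos_act_tr pos_simple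
  pos_gen len_tr lenK gen_ind huv.
have hlin := height_linear c.
(* [e] sets the tie-breaking: [true] yields the largest maximizer in Bruhat order, [false] the
   smallest. *)
have ext e : exists2 x, itv u v x & forall z, itv u v z -> height c z <= height c x /\
    (height c z = height c x -> if e then ble z x else ble x z).
  have [w hw] := lex_dominant c e; have [x hx] := hmat w.
  exists x; first by case: hx.
  exact: (max_linear act1 actM tr_act tr_sq pos_act_tr len_tr hlin hw hx).
have [y hy ymax] := ext true; have [x hx xmax] := ext false.
have exy : height c y = height c x.
  by apply/eqP; rewrite eq_le (xmax _ hy).1 (ymax _ hx).1.
have hxy : ble x y by apply: (xmax _ hy).2.
exists x, y; split=> //; [by case: hx|by case: hy|].
have sub z : itv x y z -> itv u v z.
  case: hx hy => h1 _ [_ h2] [h3 h4].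
  by split; [apply: ble_trans h3|apply: ble_trans h2].
have hconst := constant_itv act1 actM tr_act tr_simple tr_sq pos_act_tr pos_simple
  pos_gen len_tr gen_ind hlin hxy (fun z hz => (xmax _ (sub _ hz)).1) exy.
have inP a b q : (exists z, bruhat_le m (val a) z /\ bruhat_le m z (val b) /\ q = z *m p)
    <-> exists2 z : W, itv a b z & q = val z *m p.
  split=> [[z [h1 [h2 ->]]]|[z [h1 h2] ->]].
    have [z' e h] := bruhat_le_inv h1 erefl; rewrite e in h2 *.
    by exists z' => //; split=> //; apply/bruhat_leP.
  by exists (val z); split; [|split=> //]; apply/bruhat_leP.
have bound a : (exists z, bruhat_le m (val u) z /\ bruhat_le m z (val v) /\ a = z *m p) ->
    (c *m a) 0 0 <= height c x.
  by case/inP => z hz ->; apply: (xmax _ hz).1.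
apply/seteqP; split=> q /=.
  case=> hq hmax; apply: (conv_face _ bound) hq _ => [|a /inP [z hz ->] hz'|].
  - by apply/inP; exists x => //; split; [apply: ble_refl|].
  - apply/inP; exists z => //; split; first exact: (xmax _ hz).2.
    by apply: (ymax _ hz).2; rewrite exy.
  by apply: hmax; apply: sub_conv; apply/inP; exists x.
move=> hq.
(* Since the height is constant on [[x, y]], every point of its hull attains the maximum. *)
have cq : (c *m q) 0 0 = height c x.
  have [k [a [l [ha [hl [hsum ->]]]]]] := hq.
  rewrite mulmx_sumr summxE -[RHS]mul1r -hsum mulr_suml; apply: eq_bigr => i _.
  by have /inP [z /hconst <- ->] := ha i; rewrite -scalemxAr mxE.
split; last by move=> q' hq'; rewrite cq; apply: conv_bound bound hq'.
have [k [a [l [ha hl]]]] := hq; exists k, a, l; split=> // i.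
by have /inP [z /sub hz e] := ha i; apply/inP; exists z.
Qed.

End Antidominant.

End Reflections.

Unset Implicit Arguments.

Theorem theorem5p1 (R : realType) (n : nat) (m : 'I_n -> 'I_n -> nat)
  (hm : coxeter_matrix m) (hfin : finiteW R m)
  (p : 'cV[R]_n) (hp : forall s : 'I_n, ip m p (sroot R s) < 0)
  (u v : 'M[R]_n) (huv : bruhat_le m u v)
  (F : set 'cV[R]_n) (hF : is_face (BIP m u v p) F) :
  exists x y : 'M[R]_n,
    bruhat_le m u x /\ bruhat_le m x y /\ bruhat_le m y v /\ F = BIP m x y p.
Proof.
(* [insub] discards the listed matrices lying outside the group. *)
have [lW lWP] : exists lW : seq (coxW R hm), forall x, x \in lW.
  have [l hl] := hfin; exists (pmap insub l) => x.
  by rewrite mem_pmap_sub; apply/hl/coxW_inW.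
have hu : inW m u by case: huv => [|x y z []].
have [v' ev huv'] := bruhat_le_inv huv (erefl : u = val (coxW_of hm hu)).
rewrite ev in hF *.
have [x [y [hux hxy hyv ->]]] := face_itv hp lWP huv' hF.
exists (val x), (val y); split; [|split; [|split=> //]]; last exact/bruhat_leP.
  exact: (bruhat_leP (coxW_of hm hu) x).2.
exact/bruhat_leP.
Qed.
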